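(* Let $\underline{A},\overline{A}\in\mathbb{R}^{n\times n}$ with $\underline{A}\le\overline{A}$ (entrywise) and let $\mathbf{A}=\{A\in\mathbb{R}^{n\times n} : \underline{A}\le A\le\overline{A}\}$. Then $\mathbf{A}$ is strongly semimonotone if and only if $\underline{A}$ is semimonotone.
   Context: All inequalities between vectors or matrices are entrywise. A matrix property holds strongly for an interval matrix $\mathbf{A}$ if it holds for every $A\in\mathbf{A}$. For index sets $I,J\subseteq\{1,\dots,n\}$, $A_{I,J}$ is the submatrix of $A$ with rows indexed by $I$ and columns indexed by $J$. A matrix $A\in\mathbb{R}^{n\times n}$ is semimonotone (an $E_0$-matrix) if the linear complementarity problem $y=Az+q$, $y,z\ge0$, $y^Tz=0$ has a unique solution for each $q>0$; equivalently, if for each $\emptyset\ne I\subseteq\{1,\dots,n\}$ the system $A_{I,I}x<0$, $x\ge0$ is infeasible. *)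

(* Defs.v *)
From mathcomp Require Import all_boot all_order all_algebra.
From mathcomp Require Import classical_sets reals.

Set Implicit Arguments.
Unset Strict Implicit.
Unset Printing Implicit Defensive.

Import Order.TTheory GRing.Theory Num.Theory.

Local Open Scope classical_set_scope.
Local Open Scope ring_scope.

(* Entrywise (partial) order; [mx_lt] is strict in every entry, so it is not
   the strict part of [mx_le]. *)
Definition mx_le (R : realType) (m n : nat) (A B : 'M[R]_(m, n)) : Prop :=
  forall i j, A i j <= B i j.

Definition mx_lt (R : realType) (m n : nat) (A B : 'M[R]_(m, n)) : Prop :=
  forall i j, A i j < B i j.

Definition lcp_solution (R : realType) (n : nat) (A : 'M[R]_n) (q y z : 'cV[R]_n)
    : Prop :=
  [/\ y = A *m z + q, mx_le 0 y, mx_le 0 z & y^T *m z = 0].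

Definition semimonotone (R : realType) (n : nat) (A : 'M[R]_n) : Prop :=
  forall q : 'cV[R]_n, mx_lt 0 q ->
    exists! yz : 'cV[R]_n * 'cV[R]_n, lcp_solution A q yz.1 yz.2.

Definition interval_mx (R : realType) (m n : nat) (Al Au : 'M[R]_(m, n))
    : set 'M[R]_(m, n) :=
  [set A | mx_le Al A /\ mx_le A Au].

Definition strongly (R : realType) (m n : nat) (P : 'M[R]_(m, n) -> Prop)
    (AA : set 'M[R]_(m, n)) : Prop :=
  forall A, AA A -> P A.

(* Main.v *)
(* The pair (q, 0) always solves the LCP when q > 0, so semimonotonicity says that
   no solution has z <> 0.  If (y, z) solves the LCP of A >= Al, then on the
   support of z we have Al z <= A z = - q < 0; hence z also solves the LCP of Al
   for the positive vector q' equal to - Al z on the support and large elsewhere. *)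
Require Import Defs.
From mathcomp Require Import all_boot all_order all_algebra.
From mathcomp Require Import classical_sets reals.

Set Implicit Arguments.
Unset Strict Implicit.
Unset Printing Implicit Defensive.

Import Order.TTheory GRing.Theory Num.Theory.

Local Open Scope ring_scope.

Lemma lcp_solution_zero (R : realType) (n : nat) (A : 'M[R]_n) (q : 'cV[R]_n) :
  mx_lt 0 q -> lcp_solution A q q 0.
Proof.
move=> q_gt0; split; rewrite ?mulmx0 ?add0r // => i j.
exact/ltW/q_gt0.
Qed.

(** The equation [y = A *m z + q] determines [y] from [z], so uniqueness only concerns [z], and
    [z = 0] always occurs. *)
Lemma semimonotoneP (R : realType) (n : nat) (A : 'M[R]_n) :
  semimonotone A <->
  (forall q y z : 'cV[R]_n, mx_lt 0 q -> lcp_solution A q y z -> z = 0).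
Proof.
split=> [Asm q y z q_gt0 yz_sol | Asm q q_gt0].
  have [yz [_ uniq_yz]] := Asm q q_gt0.
  have := uniq_yz (q, 0) (lcp_solution_zero A q_gt0).
  by rewrite (uniq_yz (y, z) yz_sol) => -[].
exists (q, 0); split=> [|[y z] /= yz_sol]; first exact: lcp_solution_zero.
have z0 := Asm q y z q_gt0 yz_sol.
by case: yz_sol => -> _ _ _; rewrite z0 mulmx0 add0r.
Qed.

(** A sum of nonnegative terms vanishes only if each term does. *)
Lemma complementarityP (R : realType) (n : nat) (y z : 'cV[R]_n) :
  mx_le 0 y -> mx_le 0 z ->
  (y^T *m z = 0 <-> forall i, y i 0 * z i 0 = 0).
Proof.
move=> y_ge0 z_ge0; split=> [yz0 i | yz0].
  have : \sum_j y j 0 * z j 0 = 0.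
    move/matrixP/(_ 0 0): yz0; rewrite !mxE; apply: etrans.
    by apply: eq_bigr => j _; rewrite mxE.
  move/psumr_eq0P => -> // j _; apply: mulr_ge0.
    by have := y_ge0 j 0; rewrite mxE.
  by have := z_ge0 j 0; rewrite mxE.
apply/matrixP => i j; rewrite !ord1 !mxE big1 // => k _.
by rewrite mxE yz0.
Qed.

Lemma mulmx_le2r (R : realType) (m n p : nat) (A B : 'M[R]_(m, n))
    (C : 'M[R]_(n, p)) :
  mx_le 0 C -> mx_le A B -> mx_le (A *m C) (B *m C).
Proof.
move=> C_ge0 leAB i j; rewrite !mxE; apply: ler_sum => k _.
by apply: ler_wpM2r => //; have := C_ge0 k j; rewrite mxE.
Qed.

Lemma semimonotone_le (R : realType) (n : nat) (A B : 'M[R]_n) :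
  mx_le A B -> semimonotone A -> semimonotone B.
Proof.
move=> leAB /semimonotoneP Asm; apply/semimonotoneP.
move=> q y z q_gt0 [yE y_ge0 z_ge0 /(complementarityP y_ge0 z_ge0) yz0].
(* On the support of [z] this makes [A *m z + q'] vanish, as complementarity demands. Off it, the
   absolute value keeps [A *m z + q'] nonnegative and the 1 makes [q'] strictly positive. *)
pose q' : 'cV[R]_n :=
  \col_i if z i 0 == 0 then 1 + `|(A *m z) i 0| else - (A *m z) i 0.
have q'_gt0 : mx_lt 0 q'.
  move=> i j; rewrite ord1 [X in X < _]mxE [q' i 0]mxE.
  case: eqP => [_|/eqP zi_neq0].
    by rewrite ltr_pwDl.
  rewrite oppr_gt0; apply: le_lt_trans (mulmx_le2r z_ge0 leAB i 0) _.
  (* Since [z i 0] is nonzero, [y i 0 = 0], that is [(B *m z) i 0 = - q i 0]. *)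
  have /eqP := yz0 i.
  rewrite mulf_eq0 (negPf zi_neq0) orbF yE mxE addr_eq0 => /eqP ->.
  by rewrite oppr_lt0; have := q_gt0 i 0; rewrite mxE.
apply: (Asm q' (A *m z + q') z q'_gt0).
have y'_ge0 : mx_le 0 (A *m z + q').
  move=> i j; rewrite ord1 [X in X <= _]mxE [X in _ <= X]mxE [q' i 0]mxE.
  case: eqP => _; last by rewrite subrr.
  (* With [t] for [(A *m z) i 0], the entry is [1 + (t + |t|)], and [- t <= |t|]. *)
  by rewrite addrCA addr_ge0 // -lerBlDl sub0r -normrN ler_norm.
split=> //; apply/complementarityP => // i.
rewrite [X in X * _]mxE [q' i 0]mxE.
by case: eqP => [->|_]; rewrite ?mulr0 // subrr mul0r.
Qed.

Theorem proposition5 (R : realType) (n : nat) (Al Au : 'M[R]_n)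
    (hAlu : mx_le Al Au) :
  strongly (@semimonotone R n) (interval_mx Al Au) <-> semimonotone Al.
Proof.
split=> [Asm | Alsm A [leAlA _]]; last exact: semimonotone_le leAlA Alsm.
(* [Al] itself lies in the interval, by [hAlu]. *)
by apply: Asm; split.
Qed.
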